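(* Let $(X,d)$ be a metric space with bounded geometry, and let $p\in[1,\infty)$. The following are equivalent: \begin{enumerate} \item[(1)] $B^p_u(X)$ is a quasidiagonal set in $B(\ell^p(X))$. \item[(2)] $B^p_u(X)$ is stably finite. \item[(3)] $B^p_u(X)$ is finite. \item[(4)] For each $R>0$, every $R$-connected component of $X$ is finite. \end{enumerate}
   Context: A metric space $(X,d)$ has bounded geometry if for any $R>0$ there exists $N_R>0$ such that $|B_R(x)|\le N_R$ for all $x\in X$, where $B_R(x)$ is the closed ball of radius $R$ centered at $x$ (so $X$ is countable and discrete). For $T\in B(\ell^p(X))$ write $T_{xy}=(T\delta_y)(x)$ and $\mathrm{prop}(T)=\sup\{d(x,y):x,y\in X,\ T_{xy}\neq 0\}\in[0,\infty]$. The $\ell^p$ uniform Roe algebra $B^p_u(X)$ is the operator norm closure in $B(\ell^p(X))$ of the algebra of all bounded operators on $\ell^p(X)$ with finite propagation. Quasidiagonal set: for a Banach space $E$, a collection $A\subseteq B(E)$ is a quasidiagonal set of operators on $E$ (in $B(E)$) if for each finite set $M\subset A$, each finite set $F\subset E$ and each $\varepsilon>0$, there is a finite rank idempotent operator $P$ on $E$ of norm one such that $\|SP-PS\|<\varepsilon$ and $\|P\xi-\xi\|<\varepsilon$ for all $S\in M$ and $\xi\in F$. Finiteness: idempotents $e,f$ in an algebra $A$ are algebraically equivalent, $e\sim f$, if there exist $x,y\in A$ with $e=xy$ and $f=yx$; $f\le e$ means $ef=fe=f$. An idempotent $e$ is finite if whenever $f$ is an idempotent with $e\sim f$ and $f\le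 e$, then $f=e$. A unital algebra $A$ is finite if $1_A$ is a finite idempotent, and stably finite if $M_n(A)$ is finite for all $n\in\mathbb{N}$. $R$-connected components: $x,y\in X$ are $R$-connected if there is a finite sequence $x_0=x,x_1,\ldots,x_n=y$ in $X$ with $d(x_i,x_{i+1})\le R$ for $i=0,\ldots,n-1$. This is an equivalence relation, whose classes are the $R$-connected components of $X$. *)

(* Defs.v *)
From HB Require Import structures.
From mathcomp Require Import all_boot all_order all_algebra.
From mathcomp Require Import all_classical all_reals all_analysis.
From mathcomp Require Import complex.

Set Implicit Arguments.
Unset Strict Implicit.
Unset Printing Implicit Defensive.

Import Order.TTheory GRing.Theory Num.Theory.
Import numFieldNormedType.Exports.

Local Open Scope classical_set_scope.
Local Open Scope ring_scope.
Local Open Scope complex_scope.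

(* Norms on a normed module over R[i] take values in R[i]; [rnorm v] is the
   same nonnegative number as an element of R (see [rnormE]). *)
Definition rnorm (R : realType) (V : normedZmodType R[i]) (v : V) : R :=
  complex.Re `|v|.

Section RealNorm.
Variable R : realType.

Lemma rnormE (V : normedZmodType R[i]) (v : V) : (rnorm v)%:C = `|v|.
Proof.
rewrite /rnorm; have := normr_ge0 v; case: (`|v|) => a b.
by rewrite lecE /= => /andP[/eqP -> _].
Qed.

Lemma rnorm_ge0 (V : normedZmodType R[i]) (v : V) : 0 <= rnorm v.
Proof. by rewrite -lecR rnormE normr_ge0. Qed.

Lemma rnormD (V : normedZmodType R[i]) (u v : V) :
  rnorm (u + v) <= rnorm u + rnorm v.
Proof. by rewrite -lecR rmorphD /= !rnormE ler_normD. Qed.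

Lemma rnormN (V : normedZmodType R[i]) (v : V) : rnorm (- v) = rnorm v.
Proof. by rewrite /rnorm normrN. Qed.

Lemma rnorm0 (V : normedZmodType R[i]) : rnorm (0 : V) = 0.
Proof. by rewrite /rnorm normr0. Qed.

Lemma rnorm_eq0 (V : normedZmodType R[i]) (v : V) : rnorm v = 0 -> v = 0.
Proof. by move=> v0; apply/eqP; rewrite -normr_eq0 -rnormE v0. Qed.

Lemma rnormM (a b : R[i]) : rnorm (a * b) = rnorm a * rnorm b.
Proof. by apply: complexI; rewrite rmorphM /= !rnormE normrM. Qed.

Lemma rnormZ (V : normedModType R[i]) (a : R[i]) (v : V) :
  rnorm (a *: v) = rnorm a * rnorm v.
Proof. by apply: complexI; rewrite rmorphM /= !rnormE normrZ. Qed.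

Lemma rnormR (a : R) : rnorm a%:C = `|a|.
Proof. by apply: complexI; rewrite rnormE normc_def /= expr0n addr0 sqrtr_sqr. Qed.

End RealNorm.

(* Scalars are complex; [lp p1 X] is the space of f : X -> R[i] such that the
   sum of |f x|^p over the arbitrary index set X is finite, normed by
   (sum |f x|^p)^(1/p). *)
Definition lp_sum (R : realType) (p : R) (X : choiceType) (f : X -> R[i]^o) :
  \bar R := \esum_(x in [set: X]) (rnorm (f x : R[i]) `^ p)%:E.

Definition lp_pred (R : realType) (p : R) (p1 : 1 <= p) (X : choiceType) :
  {pred X -> R[i]^o} := mem [set f | (lp_sum p f < +oo)%E].
Arguments lp_pred {R p} p1 X _.

Section LpSum.
Variables (R : realType) (p : R) (p1 : 1 <= p) (X : choiceType).
Implicit Types f g : X -> R[i]^o.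

Let p0 : 0 < p. Proof. exact: lt_le_trans p1. Qed.

Lemma lp_predE f : (f \in lp_pred p1 X) = (lp_sum p f < +oo)%E.
Proof. by apply/idP/idP; rewrite inE. Qed.

Lemma lp_sum_ge0 f : (0 <= lp_sum p f)%E.
Proof. by apply: esum_ge0 => x _; rewrite lee_fin powR_ge0. Qed.

Lemma le_esumZ (c : R) (a : X -> \bar R) : 0 <= c -> (forall x, 0 <= a x)%E ->
  (\esum_(x in [set: X]) (c%:E * a x) <= c%:E * \esum_(x in [set: X]) a x)%E.
Proof.
move=> c0 a0; apply: ge_ereal_sup => _ [F FX <-].
rewrite -ge0_mule_fsumr; last by move=> x; exact: a0.
by rewrite lee_wpmul2l ?lee_fin//; apply: ereal_sup_ubound; exists F.
Qed.

Lemma lp_sum_term f x : (lp_sum p f < +oo)%E ->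
  rnorm (f x : R[i]) `^ p <= fine (lp_sum p f).
Proof.
move=> foo; rewrite -lee_fin fineK ?ge0_fin_numE ?lp_sum_ge0//.
rewrite -(@esum_set1 R X x (fun x => (rnorm (f x : R[i]) `^ p)%:E)) ?lee_fin ?powR_ge0//.
rewrite esum_mkcond; apply: le_esum => y _.
by case: ifP => // _; rewrite lee_fin powR_ge0.
Qed.

Lemma powR_convex (t u v : R) : 0 <= t -> t <= 1 -> 0 <= u -> 0 <= v ->
  (t * u + (1 - t) * v) `^ p <= t * u `^ p + (1 - t) * v `^ p.
Proof.
move=> t0 t1 u0 v0.
have := @convex_powR R p p1 (Itv01 t0 t1) u v.
rewrite !inE /= !in_itv /= !andbT => /(_ u0 v0) h.
exact: h.
Qed.

Lemma lp_sumD f g a b : 0 < a -> 0 < b ->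
  (lp_sum p f <= (a `^ p)%:E)%E -> (lp_sum p g <= (b `^ p)%:E)%E ->
  (lp_sum p (f + g)%R <= ((a + b) `^ p)%:E)%E.
Proof.
move=> a0 b0 fa gb.
have ab0 : 0 < a + b by rewrite addr_gt0.
have t0 : 0 <= a / (a + b) by rewrite divr_ge0 // ltW.
have t1 : a / (a + b) <= 1 by rewrite ler_pdivrMr// mul1r lerDl ltW.
have tb : 1 - a / (a + b) = b / (a + b).
  by rewrite -[X in X - _](@divff _ (a + b)) ?gt_eqF// -mulrBl addrAC subrr add0r.
have ap : 0 < a `^ p by rewrite powR_gt0.
have bp : 0 < b `^ p by rewrite powR_gt0.
pose c1 := (a + b) `^ p * (a / (a + b)) / a `^ p.
pose c2 := (a + b) `^ p * (b / (a + b)) / b `^ p.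
have c10 : 0 <= c1.
  by rewrite !mulr_ge0 ?powR_ge0 ?invr_ge0 ?powR_ge0 ?(ltW a0) ?(ltW ab0).
have c20 : 0 <= c2.
  by rewrite !mulr_ge0 ?powR_ge0 ?invr_ge0 ?powR_ge0 ?(ltW b0) ?(ltW ab0).
have powV (c u : R) : 0 < c -> 0 <= u -> (u / c) `^ p = u `^ p / c `^ p.
  move=> c0 u0; apply: (@mulIf _ (c `^ p)); first by rewrite gt_eqF ?powR_gt0.
  rewrite -powRM ?divr_ge0 ?(ltW c0)// !divfK ?gt_eqF ?powR_gt0//.
have pt (u v : R) : 0 <= u -> 0 <= v ->
    (u + v) `^ p <= c1 * u `^ p + c2 * v `^ p.
  move=> u0 v0.
  have ua : 0 <= u / a by rewrite divr_ge0 // ltW.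
  have vb : 0 <= v / b by rewrite divr_ge0 // ltW.
  have := powR_convex t0 t1 ua vb; rewrite tb.
  have -> : a / (a + b) * (u / a) + b / (a + b) * (v / b) = (u + v) / (a + b).
    rewrite mulrDl; congr (_ + _).
      by rewrite mulrC mulrA divfK ?gt_eqF.
    by rewrite mulrC mulrA divfK ?gt_eqF.
  rewrite !powV ?addr_ge0// => h.
  have := ler_wpM2l (powR_ge0 (a + b) p) h.
  rewrite mulrCA divff ?mulr1 ?gt_eqF ?powR_gt0// => /le_trans; apply.
  rewrite mulrDr /c1 /c2 le_eqVlt; apply/orP; left; apply/eqP.
  by congr (_ + _); rewrite !mulrA [RHS]mulrAC.
have -> : (a + b) `^ p = c1 * a `^ p + c2 * b `^ p.
  rewrite /c1 /c2 !divfK ?gt_eqF// -mulrDr -mulrDl divff ?mulr1// gt_eqF//.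
apply: (@le_trans _ _ (\esum_(x in [set: X])
    (c1%:E * (rnorm (f x : R[i]) `^ p)%:E + c2%:E * (rnorm (g x : R[i]) `^ p)%:E))%E).
  apply: le_esum => x _; rewrite -!EFinM -EFinD lee_fin.
  apply: le_trans (pt _ _ (rnorm_ge0 _) (rnorm_ge0 _)).
  rewrite ge0_ler_powR ?(ltW p0)// ?nnegrE ?addr_ge0 ?rnorm_ge0//.
  exact: rnormD.
have fE x : (0 <= (rnorm (f x : R[i]) `^ p)%:E)%E by rewrite lee_fin powR_ge0.
have gE x : (0 <= (rnorm (g x : R[i]) `^ p)%:E)%E by rewrite lee_fin powR_ge0.
rewrite esumD; last 2 first.
- by move=> x _; rewrite mule_ge0 ?lee_fin ?powR_ge0.
- by move=> x _; rewrite mule_ge0 ?lee_fin ?powR_ge0.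
rewrite EFinD !EFinM; apply: leeD.
- by apply: (le_trans (le_esumZ c10 fE)); rewrite lee_wpmul2l ?lee_fin.
- by apply: (le_trans (le_esumZ c20 gE)); rewrite lee_wpmul2l ?lee_fin.
Qed.

Lemma lp_sumZ (c : R[i]) f :
  (lp_sum p (c *: f) <= (rnorm c `^ p)%:E * lp_sum p f)%E.
Proof.
apply: le_trans (le_esumZ (powR_ge0 _ _) _); last first.
  by move=> x; rewrite lee_fin powR_ge0.
apply: le_esum => x _; rewrite -EFinM lee_fin.
by rewrite [X in rnorm X]/= rnormM powRM ?rnorm_ge0.
Qed.

Definition lp_nrm f : R := fine (lp_sum p f) `^ p^-1.

Lemma lp_nrm_ge0 f : 0 <= lp_nrm f. Proof. exact: powR_ge0. Qed.

Lemma lp_nrm_powR f : (lp_sum p f < +oo)%E ->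
  lp_sum p f = (lp_nrm f `^ p)%:E.
Proof.
move=> foo; rewrite /lp_nrm -powRrM mulVf ?gt_eqF// powRr1.
  by rewrite fineK// ge0_fin_numE// lp_sum_ge0.
exact/fine_ge0/lp_sum_ge0.
Qed.

Lemma lp_nrm_le f a : 0 <= a -> (lp_sum p f <= (a `^ p)%:E)%E -> lp_nrm f <= a.
Proof.
move=> a0 fa; have foo : (lp_sum p f < +oo)%E by rewrite (le_lt_trans fa)// ltry.
rewrite -(@powRr1 _ a)// -[X in a `^ X](@mulfV _ p) ?gt_eqF// powRrM.
rewrite ge0_ler_powR ?invr_ge0 ?(ltW p0)// ?nnegrE ?powR_ge0//.
  exact/fine_ge0/lp_sum_ge0.
by rewrite -lee_fin fineK// ge0_fin_numE// lp_sum_ge0.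
Qed.

Lemma lp_pred_submod : submod_closed (lp_pred p1 X).
Proof.
split=> [|c f g].
  rewrite lp_predE /lp_sum esum1 ?ltry// => x _.
  by rewrite rnorm0 powR0// gt_eqF.
rewrite !lp_predE => foo goo.
have cf : (lp_sum p (c *: f) < +oo)%E.
  apply: (le_lt_trans (lp_sumZ c f)).
  by rewrite (lp_nrm_powR foo) -EFinM ltry.
have le1 h : (lp_sum p h < +oo)%E ->
    (lp_sum p h <= ((lp_nrm h + 1) `^ p)%:E)%E.
  move=> hoo; rewrite (lp_nrm_powR hoo) lee_fin ge0_ler_powR ?(ltW p0)//.
  - by rewrite nnegrE lp_nrm_ge0.
  - by rewrite nnegrE addr_ge0 ?lp_nrm_ge0.
  - by rewrite lerDl.
apply: le_lt_trans (lp_sumD _ _ (le1 _ cf) (le1 _ goo)) (ltry _);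
  by rewrite ltr_wpDl ?lp_nrm_ge0.
Qed.

Lemma lp_nrmD f g : (lp_sum p f < +oo)%E -> (lp_sum p g < +oo)%E ->
  lp_nrm (f + g) <= lp_nrm f + lp_nrm g.
Proof.
move=> foo goo; apply/ler_addgt0Pr => e e0.
have le1 h : (lp_sum p h < +oo)%E ->
    (lp_sum p h <= ((lp_nrm h + e / 2) `^ p)%:E)%E.
  move=> hoo; rewrite (lp_nrm_powR hoo) lee_fin ge0_ler_powR ?(ltW p0)//.
  - by rewrite nnegrE lp_nrm_ge0.
  - by rewrite nnegrE addr_ge0 ?lp_nrm_ge0// divr_ge0// ltW.
  - by rewrite lerDl divr_ge0// ltW.
rewrite [e]splitr addrACA; apply: lp_nrm_le.
  by rewrite !addr_ge0 ?lp_nrm_ge0 ?divr_ge0 ?(ltW e0).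
by apply: lp_sumD; rewrite ?le1// ltr_wpDl ?lp_nrm_ge0// divr_gt0.
Qed.

Lemma lp_nrmZ_le (c : R[i]) f : (lp_sum p f < +oo)%E ->
  lp_nrm (c *: f) <= rnorm c * lp_nrm f.
Proof.
move=> foo; apply: lp_nrm_le; first by rewrite mulr_ge0 ?rnorm_ge0 ?lp_nrm_ge0.
apply: (le_trans (lp_sumZ c f)).
by rewrite (lp_nrm_powR foo) -EFinM powRM ?rnorm_ge0 ?lp_nrm_ge0.
Qed.

Lemma lp_nrmZ (c : R[i]) f : (lp_sum p f < +oo)%E ->
  lp_nrm (c *: f) = rnorm c * lp_nrm f.
Proof.
move=> foo; apply/eqP; rewrite eq_le lp_nrmZ_le//=.
have [->|c0] := eqVneq c 0; first by rewrite rnorm0 mul0r lp_nrm_ge0.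
have cf : (lp_sum p (c *: f) < +oo)%E.
  by rewrite (le_lt_trans (lp_sumZ c f))// (lp_nrm_powR foo) -EFinM ltry.
have rc0 : 0 < rnorm c.
  by rewrite lt_neqAle rnorm_ge0 andbT eq_sym; apply: contra_neq c0 => /rnorm_eq0.
have := lp_nrmZ_le c^-1 cf; rewrite scalerA mulVf// scale1r.
have h : rnorm c^-1 = (rnorm c)^-1.
  apply: (@mulfI _ (rnorm c)); first by rewrite gt_eqF.
  rewrite -rnormM (divff c0) divff ?(gt_eqF rc0)//.
  by apply: complexI; rewrite rnormE normr1.
by rewrite h => H; rewrite -ler_pdivlMl//.
Qed.

Lemma rnorm_le_lp_nrm f x : (lp_sum p f < +oo)%E ->
  rnorm (f x : R[i]) <= lp_nrm f.
Proof.
move=> foo; rewrite -(@powRr1 _ (rnorm _)) ?rnorm_ge0//.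
rewrite -[X in _ `^ X](@mulfV _ p) ?gt_eqF// powRrM.
rewrite ge0_ler_powR ?invr_ge0 ?(ltW p0)// ?nnegrE ?powR_ge0//.
  exact/fine_ge0/lp_sum_ge0.
exact: lp_sum_term.
Qed.

Lemma lp_nrm_eq0 f : (lp_sum p f < +oo)%E -> lp_nrm f = 0 -> f = 0.
Proof.
move=> foo f0; apply/funext => x; apply: rnorm_eq0; apply/eqP.
by rewrite eq_le rnorm_ge0 andbT -f0 rnorm_le_lp_nrm.
Qed.

End LpSum.

Record lp (R : realType) (p : R) (p1 : 1 <= p) (X : choiceType) := Lp {
  lp_fun :> X -> R[i]^o;
  lp_funP : lp_fun \in lp_pred p1 X }.

Section LpNormed.
Variables (R : realType) (p : R) (p1 : 1 <= p) (X : choiceType).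

HB.instance Definition _ := [isSub for @lp_fun R p p1 X].
HB.instance Definition _ := [Choice of lp p1 X by <:].
HB.instance Definition _ :=
  GRing.isSubmodClosed.Build R[i] (X -> R[i]^o) (lp_pred p1 X)
    (lp_pred_submod p1 X).
HB.instance Definition _ := [SubChoice_isSubLmodule of lp p1 X by <:].

Implicit Types f g : lp p1 X.

Lemma lp_sum_fin f : (lp_sum p f < +oo)%E.
Proof. by have := lp_funP f; rewrite lp_predE. Qed.

Definition lp_norm f : R[i] := (lp_nrm p f)%:C.

Lemma lp_normD f g : lp_norm (f + g) <= lp_norm f + lp_norm g.
Proof. by rewrite -rmorphD lecR lp_nrmD ?lp_sum_fin. Qed.

Lemma lp_normZ (c : R[i]) f : lp_norm (c *: f) = `|c| * lp_norm f.
Proof. by rewrite -(rnormE c) -rmorphM /= -lp_nrmZ ?lp_sum_fin. Qed.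

Lemma lp_norm_eq0 f : lp_norm f = 0 -> f = 0.
Proof.
move=> /complexI f0; apply: val_inj; apply: (lp_nrm_eq0 p1) f0.
exact: lp_sum_fin.
Qed.

HB.instance Definition _ :=
  Lmodule_isNormed.Build R[i] (lp p1 X) lp_normD lp_normZ lp_norm_eq0.

Lemma delta_in_lp (y : X) :
  (fun x => (x == y)%:R : R[i]^o) \in lp_pred p1 X.
Proof.
have p0 : 0 < p by exact: lt_le_trans p1.
rewrite lp_predE /lp_sum (eq_esum (b := fun x => if x \in [set y] then 1%:E else 0)).
  by rewrite -esum_mkcond esum_set1 ?lee01// ltry.
move=> x _; have -> : (x \in [set y]) = (x == y) by apply/idP/eqP; rewrite inE.
case: eqP => _.
- by rewrite (rnormR 1) normr1 powR1.
- by rewrite rnorm0 powR0 ?gt_eqF.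
Qed.

Definition delta (y : X) : lp p1 X := Lp (delta_in_lp y).

End LpNormed.

(* [bop E] is B(E): a complex normed space under the operator norm, and a ring
   under composition. It is only a [pzRingType] since E may be zero. *)
Definition bounded_linear (R : realType) (E : normedModType R[i])
    (f : E -> E) : Prop :=
  linear f /\ exists M : R, forall x, rnorm (f x) <= M * rnorm x.

Definition bop_pred (R : realType) (E : normedModType R[i]) : {pred E -> E} :=
  mem [set f | bounded_linear f].
Arguments bop_pred {R} E _.

Record bop (R : realType) (E : normedModType R[i]) := Bop {
  bop_fun :> E -> E;
  bop_funP : bop_fun \in bop_pred E }.

(* The operator norm; its values are again taken in R. *)
Definition opnorm (R : realType) (E : normedModType R[i]) (f : E -> E) : R :=
  sup [set rnorm (f x) | x in [set x | rnorm x <= 1]].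

Section BoundedOperators.
Variables (R : realType) (E : normedModType R[i]).
Implicit Types f g : E -> E.

Lemma bop_predP f : reflect (bounded_linear f) (f \in bop_pred E).
Proof. by apply: (iffP idP); rewrite inE. Qed.

Lemma bounded_linear0 f : bounded_linear f -> f 0 = 0.
Proof. by case=> lf _; rewrite -[X in f X](addNr 0) -scaleN1r lf scaleN1r addNr. Qed.

Lemma opnorm_has_sup f : bounded_linear f ->
  has_sup [set rnorm (f x) | x in [set x | rnorm x <= 1]].
Proof.
move=> bf; split; first by exists (rnorm (f 0)), 0 => //=; rewrite rnorm0.
case: bf => _ [M fM]; exists `|M| => _ [x /= x1 <-].
apply: (le_trans (fM x)); apply: le_trans (ler_norm _) _.
by rewrite normrM ler_piMr // ger0_norm ?rnorm_ge0.
Qed.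

Lemma opnorm_ge0 f : bounded_linear f -> 0 <= opnorm f.
Proof.
move=> bf; rewrite -(@rnorm0 R E) -(bounded_linear0 bf).
apply: (ub_le_sup (opnorm_has_sup bf).2).
by exists 0 => //=; rewrite rnorm0.
Qed.

Lemma le_opnorm f x : bounded_linear f -> rnorm (f x) <= opnorm f * rnorm x.
Proof.
move=> bf; have [->|x0] := eqVneq x 0.
  by rewrite (bounded_linear0 bf) !rnorm0 mulr0.
have nx0 : 0 < rnorm x.
  by rewrite lt_neqAle rnorm_ge0 andbT eq_sym; apply: contra_neq x0 => /rnorm_eq0.
rewrite -ler_pdivrMr// mulrC.
have rV : rnorm (rnorm x)^-1%:C = (rnorm x)^-1.
  by rewrite rnormR ger0_norm// invr_ge0 ltW.
rewrite -rV -rnormZ.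
have -> : (rnorm x)^-1%:C *: f x = f ((rnorm x)^-1%:C *: x).
  by have := bf.1 (rnorm x)^-1%:C x 0; rewrite (bounded_linear0 bf) !addr0.
apply: (ub_le_sup (opnorm_has_sup bf).2).
by exists ((rnorm x)^-1%:C *: x) => //=; rewrite rnormZ rV mulVf// gt_eqF.
Qed.

Lemma opnorm_le f (M : R) : 0 <= M -> bounded_linear f ->
  (forall x, rnorm (f x) <= M * rnorm x) -> opnorm f <= M.
Proof.
move=> M0 bf fM; apply: ge_sup; first exact: (opnorm_has_sup bf).1.
move=> _ [x /= x1 <-]; apply: (le_trans (fM x)).
by rewrite ler_piMr.
Qed.

Lemma bop_pred_submod : submod_closed (bop_pred E).
Proof.
split=> [|a f g].
  apply/bop_predP; split; first by move=> a u v; rewrite /= scaler0 addr0.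
  by exists 0 => x; rewrite rnorm0 mul0r.
move=> /bop_predP[lf [M fM]] /bop_predP[lg [N gN]]; apply/bop_predP; split.
  move=> b u v; rewrite [LHS]/(a *: f (b *: u + v) + g (b *: u + v)).
  rewrite [RHS]/(b *: (a *: f u + g u) + (a *: f v + g v)) lf lg.
  by rewrite !scalerDr !scalerA (mulrC a b); exact: addrACA.
exists (rnorm a * M + N) => x.
rewrite mulrDl; apply: (le_trans (rnormD _ _)).
by rewrite rnormZ -mulrA lerD ?gN// ler_wpM2l ?rnorm_ge0.
Qed.

HB.instance Definition _ := [isSub for @bop_fun R E].
HB.instance Definition _ := [Choice of bop E by <:].
HB.instance Definition _ :=
  GRing.isSubmodClosed.Build R[i] (E -> E) (bop_pred E) bop_pred_submod.
HB.instance Definition _ := [SubChoice_isSubLmodule of bop E by <:].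

Implicit Types S T U : bop E.

Lemma bopP T : bounded_linear T.
Proof. by apply/bop_predP; exact: bop_funP. Qed.

Lemma bop_ext S T : (S : E -> E) =1 T -> S = T.
Proof. by move=> ST; apply: val_inj; apply/funext. Qed.

Lemma bopDE S T x : (S + T) x = S x + T x. Proof. by []. Qed.

Lemma bopNE T x : (- T) x = - T x. Proof. by []. Qed.

Lemma bopZE (a : R[i]) T x : (a *: T) x = a *: T x. Proof. by []. Qed.

Lemma bop_linD T x y : T (x + y) = T x + T y.
Proof. by have := (bopP T).1 1 x y; rewrite !scale1r. Qed.

Lemma bop_lin0 T : T 0 = 0. Proof. exact: bounded_linear0 (bopP T). Qed.

Lemma bop_linZ T (a : R[i]) x : T (a *: x) = a *: T x.
Proof. by have := (bopP T).1 a x 0; rewrite !addr0 bop_lin0 addr0. Qed.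

Lemma bop_linN T x : T (- x) = - T x.
Proof. by rewrite -scaleN1r bop_linZ scaleN1r. Qed.

Lemma bop_id_in : (idfun : E -> E) \in bop_pred E.
Proof. by apply/bop_predP; split=> //; exists 1 => x; rewrite mul1r. Qed.

Lemma bop_comp_in S T : (S \o T : E -> E) \in bop_pred E.
Proof.
apply/bop_predP; split=> [a u v|] /=.
  by rewrite bop_linD bop_linZ bop_linD bop_linZ.
exists (opnorm S * opnorm T) => x /=.
apply: (le_trans (le_opnorm (T x) (bopP S))).
rewrite -mulrA ler_wpM2l ?le_opnorm ?opnorm_ge0//; exact: bopP.
Qed.

Definition bop1 : bop E := Bop bop_id_in.
Definition bop_mul S T : bop E := Bop (bop_comp_in S T).

Lemma bop_mulA : associative bop_mul.
Proof. by move=> S T U; apply: bop_ext. Qed.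

Lemma bop_mul1l : left_id bop1 bop_mul.
Proof. by move=> S; apply: bop_ext. Qed.

Lemma bop_mul1r : right_id bop1 bop_mul.
Proof. by move=> S; apply: bop_ext. Qed.

Lemma bop_mulDl : left_distributive bop_mul +%R.
Proof. by move=> S T U; apply: bop_ext. Qed.

Lemma bop_mulDr : right_distributive bop_mul +%R.
Proof. by move=> S T U; apply: bop_ext => x; exact: bop_linD. Qed.

HB.instance Definition _ := GRing.Zmodule_isPzRing.Build (bop E)
  bop_mulA bop_mul1l bop_mul1r bop_mulDl bop_mulDr.

Lemma bopME S T x : (S * T) x = S (T x). Proof. by []. Qed.

Definition bop_norm T : R[i] := (opnorm T)%:C.

Lemma bop_normD S T : bop_norm (S + T) <= bop_norm S + bop_norm T.
Proof.
rewrite -rmorphD lecR; apply: opnorm_le; last 1 first.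
- move=> x; apply: (le_trans (rnormD _ _)).
  by rewrite mulrDl lerD ?le_opnorm//; exact: bopP.
- by rewrite addr_ge0 ?opnorm_ge0//; exact: bopP.
- exact: bopP.
Qed.

Lemma opnormZ_le (a : R[i]) T : opnorm (a *: T) <= rnorm a * opnorm T.
Proof.
apply: opnorm_le; last 1 first.
- by move=> x; rewrite bopZE rnormZ -mulrA ler_wpM2l ?rnorm_ge0 ?le_opnorm//; exact: bopP.
- by rewrite mulr_ge0 ?rnorm_ge0 ?opnorm_ge0//; exact: bopP.
- exact: bopP.
Qed.

Lemma bop_normZ (a : R[i]) T : bop_norm (a *: T) = `|a| * bop_norm T.
Proof.
rewrite -(rnormE a) -rmorphM /=; congr (_%:C); apply/eqP.
rewrite eq_le opnormZ_le andTb.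
have [->|a0] := eqVneq a 0.
  by rewrite rnorm0 mul0r opnorm_ge0//; exact: bopP.
have ra0 : 0 < rnorm a.
  by rewrite lt_neqAle rnorm_ge0 andbT eq_sym; apply: contra_neq a0 => /rnorm_eq0.
have := opnormZ_le a^-1 (a *: T); rewrite scalerA mulVf// scale1r.
have h : rnorm a^-1 = (rnorm a)^-1.
  apply: (@mulfI _ (rnorm a)); first by rewrite gt_eqF.
  rewrite -rnormM (divff a0) divff ?(gt_eqF ra0)//.
  by apply: complexI; rewrite rnormE normr1.
by rewrite h => H; rewrite -ler_pdivlMl//.
Qed.

Lemma bop_norm_eq0 T : bop_norm T = 0 -> T = 0.
Proof.
move=> /complexI T0; apply: bop_ext => x; apply: rnorm_eq0; apply/eqP.
by rewrite eq_le rnorm_ge0 andbT (le_trans (le_opnorm x (bopP T)))// T0 mul0r.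
Qed.

HB.instance Definition _ :=
  Lmodule_isNormed.Build R[i] (bop E) bop_normD bop_normZ bop_norm_eq0.

Lemma rnorm_bopE T : rnorm T = opnorm T.
Proof. by []. Qed.

Lemma rnorm_bopM S T : rnorm (S * T) <= rnorm S * rnorm T.
Proof.
rewrite !rnorm_bopE; have oS := opnorm_ge0 (bopP S).
have oT := opnorm_ge0 (bopP T).
apply: opnorm_le; [by rewrite mulr_ge0|exact: bopP|move=> x].
apply: (le_trans (le_opnorm (T x) (bopP S))).
by rewrite -mulrA ler_wpM2l// le_opnorm//; exact: bopP.
Qed.

Lemma closure_bopP (A : set (bop E)) T : closure A T <->
  forall e : R, 0 < e -> exists2 S, A S & rnorm (T - S) < e.
Proof.
split=> [clT e e0|appT].
- have e0' : 0 < e%:C by rewrite ltcR.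
  have [S [fS]] := clT _ (nbhsx_ballx T e%:C e0').
  rewrite -ball_normE /= => TS; exists S => //.
  by rewrite -ltcR rnormE.
- move=> B /nbhs_ballP[e /= e0 eB].
  have eE : (complex.Re e)%:C = e.
    by move: e0; case: (e) => a b; rewrite ltcE /= => /andP[/eqP ->].
  have [|S fS TS] := appT (complex.Re e); first by rewrite -ltcR eE.
  exists S; split=> //; apply: eB; rewrite -ball_normE /=.
  by rewrite -rnormE -eE ltcR.
Qed.

Lemma closure_subring (A : set (bop E)) : A 1 ->
  (forall S T, A S -> A T -> A (S - T)) ->
  (forall S T, A S -> A T -> A (S * T)) ->
  subring_closed (mem (closure A) : {pred bop E}).
Proof.
move=> A1 AB AM; split=> [|S T|S T].
- rewrite inE; apply/closure_bopP => e e0; exists 1; last by rewrite subrr rnorm0.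
  exact: A1.
- rewrite !inE => /closure_bopP S_ /closure_bopP T_; apply/closure_bopP => e e0.
  have e20 : 0 < e / 2 by rewrite divr_gt0.
  have [S' fS SS] := S_ _ e20; have [T' fT TT] := T_ _ e20.
  exists (S' - T'); first exact: AB.
  have -> : S - T - (S' - T') = (S - S') + - (T - T').
    by rewrite !opprD !opprK addrACA.
  by rewrite (le_lt_trans (rnormD _ _))// rnormN [e]splitr ltrD.
- rewrite !inE => /closure_bopP S_ /closure_bopP T_; apply/closure_bopP => e e0.
  have pos (U : bop E) (k : R) : 0 < k -> 0 < rnorm U + k.
    by move=> k0; rewrite ltr_wpDl// rnorm_ge0.
  have d0 : 0 < Num.min 1 (e / 2 / (rnorm S + 1)).
    by rewrite lt_min ltr01 !divr_gt0// pos.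
  have [T' fT] := T_ _ d0; rewrite lt_min => /andP[TT1 TT].
  have d'0 : 0 < e / 2 / (rnorm T + 1) by rewrite !divr_gt0// pos.
  have [S' fS SS] := S_ _ d'0.
  exists (S' * T'); first exact: AM.
  have -> : S * T - S' * T' = S * (T - T') + (S - S') * T'.
    by rewrite mulrBr mulrBl addrA subrK.
  have T'le : rnorm T' <= rnorm T + 1.
    have -> : T' = T + - (T - T') by rewrite opprB addrCA subrr addr0.
    by rewrite (le_trans (rnormD _ _))// rnormN lerD2l ltW.
  rewrite (le_lt_trans (rnormD _ _))// [e]splitr ltr_leD//.
  + rewrite (le_lt_trans (rnorm_bopM _ _))//.
    apply: (@le_lt_trans _ _ ((rnorm S + 1) * rnorm (T - T'))).
      by rewrite ler_wpM2r ?rnorm_ge0// lerDl.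
    by rewrite mulrC -ltr_pdivlMr ?pos.
  + rewrite (le_trans (rnorm_bopM _ _))//.
    apply: (@le_trans _ _ (rnorm (S - S') * (rnorm T + 1))).
      by rewrite ler_wpM2l ?rnorm_ge0.
    by rewrite -ler_pdivlMr ?pos// ltW.
Qed.

End BoundedOperators.

Lemma rnorm_lpE (R : realType) (p : R) (p1 : 1 <= p) (X : choiceType)
  (f : lp p1 X) : rnorm f = lp_nrm p f.
Proof. by []. Qed.

Definition finite_rank (R : realType) (E : normedModType R[i])
    (P : bop E) : Prop :=
  exists (n : nat) (v : 'I_n -> E),
    forall x, exists c : 'I_n -> R[i], P x = \sum_(i < n) c i *: v i.

(* Completeness of E plays no role in the definition. *)
Definition quasidiagonal_set (R : realType) (E : normedModType R[i])
    (A : set (bop E)) : Prop :=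
  forall (M : set (bop E)) (F : set E) (e : R),
    finite_set M -> M `<=` A -> finite_set F -> 0 < e ->
  exists P : bop E,
    [/\ finite_rank P, P * P = P, `|P| = 1,
        forall S, M S -> `|S * P - P * S| < e%:C &
        forall xi, F xi -> `|P xi - xi| < e%:C].

Definition is_idempotent (A : pzRingType) (e : A) : Prop := e * e = e.

(* Used for idempotents e and f only, see [finite_idempotent]. *)
Definition alg_equivalent (A : pzRingType) (e f : A) : Prop :=
  exists x y : A, e = x * y /\ f = y * x.

Definition idem_le (A : pzRingType) (f e : A) : Prop := e * f = f /\ f * e = f.

Definition finite_idempotent (A : pzRingType) (e : A) : Prop :=
  is_idempotent e /\
  forall f : A, is_idempotent f -> alg_equivalent e f -> idem_le f e -> f = e.

Definition finite_algebra (A : pzRingType) : Prop := finite_idempotent (1 : A).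

(* The case n = 0 is vacuous: 'M_0 is the zero ring. *)
Definition stably_finite (A : pzRingType) : Prop :=
  forall n : nat, finite_algebra 'M[A]_n.

Section MetricSpace.
Variables (R : realType) (X : metricType R).

Definition bounded_geometry : Prop :=
  forall r : R, 0 < r ->
  exists N : nat, forall x : X, ([set y : X | mdist x y <= r] #<= `I_N)%card.

(* [s] lists x_1, ..., x_n. *)
Definition connected_at (r : R) (x y : X) : Prop :=
  exists s : seq X, path (fun a b => mdist a b <= r) x s /\ last x s = y.

Definition component_at (r : R) (x : X) : set X := [set y | connected_at r x y].

End MetricSpace.

Section RoeAlgebra.
Variables (R : realType) (p : R) (p1 : 1 <= p) (X : metricType R).
Implicit Types S T : bop (lp p1 X).

Definition coef T (x y : X) : R[i] := T (delta p1 y) x.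

(* Adding 0 to the set makes the supremum 0, not -oo, when T = 0. *)
Definition propagation T : \bar R :=
  ereal_sup [set r : \bar R | r = 0%E \/
    exists x y : X, coef T x y <> 0 /\ r = (mdist x y)%:E].

Definition finite_propagation : set (bop (lp p1 X)) :=
  [set T | (propagation T < +oo)%E].

(* The closure is in the operator-norm topology of [bop]. *)
Definition roe_set : set (bop (lp p1 X)) := closure finite_propagation.

Lemma finite_propagationP T : finite_propagation T <->
  exists r : R, forall x y : X, coef T x y <> 0 -> mdist x y <= r.
Proof.
split=> [Too|[r Tr]].
- have [r rE] : exists r : R, propagation T = r%:E.
    have T0 : (0 <= propagation T)%E by apply: ereal_sup_ubound; left.
    exists (fine (propagation T)); rewrite fineK// ge0_fin_numE//.
  exists r => x y xy; rewrite -lee_fin -rE; apply: ereal_sup_ubound; right.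
  by exists x, y.
- apply: (@le_lt_trans _ _ (Num.max 0 r)%:E); last exact: ltry.
  apply: ge_ereal_sup => _ [->|[x [y [xy ->]]]]; rewrite lee_fin le_max ?lexx//.
  by rewrite Tr// orbT.
Qed.

Lemma coefB S T x y : coef (S - T) x y = coef S x y - coef T x y.
Proof. by []. Qed.

Lemma finite_propagation1 : finite_propagation 1.
Proof.
apply/finite_propagationP; exists 0 => x y; rewrite /coef /=.
by case: (eqVneq x y) => [->|_]; rewrite ?mdistxx.
Qed.

Lemma finite_propagationB S T : finite_propagation S -> finite_propagation T ->
  finite_propagation (S - T).
Proof.
move=> /finite_propagationP[r Sr] /finite_propagationP[s Ts].
apply/finite_propagationP; exists (Num.max r s) => x y; rewrite coefB => xy.
rewrite le_max; have [S0|/eqP/Sr->//] := eqVneq (coef S x y) 0.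
have [T0|/eqP/Ts->] := eqVneq (coef T x y) 0; last by rewrite orbT.
by case: xy; rewrite S0 T0 subrr.
Qed.

Lemma bop_sum T (I : Type) (s : seq I) (F : I -> lp p1 X) :
  T (\sum_(i <- s) F i) = \sum_(i <- s) T (F i).
Proof.
elim: s => [|i s IH]; first by rewrite !big_nil bop_lin0.
by rewrite !big_cons bop_linD IH.
Qed.

Lemma lp_sum_ev (I : Type) (s : seq I) (F : I -> lp p1 X) x :
  (\sum_(i <- s) F i : lp p1 X) x = \sum_(i <- s) (F i x : R[i]).
Proof. by elim: s => [|i s IH]; rewrite ?big_nil// !big_cons -IH. Qed.

Lemma delta_dense (g : lp p1 X) (e : R) : 0 < e ->
  exists s : seq X, rnorm (g - \sum_(z <- s) (g z : R[i]) *: delta p1 z) < e.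
Proof.
move=> e0; have p0 : 0 < p by exact: lt_le_trans p1.
set a := fun x : X => (rnorm (g x : R[i]) `^ p)%:E.
have a0 x : (0 <= a x)%E by rewrite lee_fin powR_ge0.
have goo := lp_sum_fin g.
have gfin : lp_sum p g \is a fin_num by rewrite ge0_fin_numE ?lp_sum_ge0.
have ep : 0 < (e / 2) `^ p by rewrite powR_gt0// divr_gt0.
have [_ [F [finF _] <-] ltF] :
  exists2 x, [set (\sum_(x \in A) a x)%E | A in fsets [set: X]] x &
    (lp_sum p g - ((e / 2) `^ p)%:E < x)%E.
  by apply: ub_ereal_sup_adherent.
pose s : seq X := finmap.enum_fset (fset_set F).
have us : uniq s by exact: finmap.fset_uniq.
have ms x : (x \in s) = (x \in F) by rewrite -(in_fset_set finF).
exists s; set h := (X in g - X).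
have hE x : (h x : R[i]) = if x \in F then (g x : R[i]) else 0.
  have -> : (h x : R[i]) = \sum_(z <- s) (g z : R[i]) * (x == z)%:R.
    by rewrite /h lp_sum_ev.
  rewrite -ms; case: ifPn => xF.
    rewrite (bigD1_seq x)//= eqxx mulr1 big1 ?addr0// => z zx.
    by rewrite eq_sym (negbTE zx) mulr0.
  rewrite big1_seq// => z /andP[_ zF]; case: eqP => [xz|_]; last by rewrite mulr0.
  by move: zF xF; rewrite -xz => ->.
rewrite rnorm_lpE; apply: (@le_lt_trans _ _ (e / 2)); last first.
  by rewrite ltr_pdivrMr// ltr_pMr// ltr1n.
apply: (lp_nrm_le p1); first by rewrite divr_ge0// ltW.
have -> : lp_sum p (g - h) = (\esum_(x in ~` F) a x)%E.
  rewrite esum_mkcond; apply: eq_esum => x _.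
  rewrite [X in rnorm X]/((g x : R[i]) - (h x : R[i])) hE in_setC.
  case: (x \in F); rewrite [~~ _]/=; last first.
    exact: (congr1 (fun u : R[i] => (rnorm u `^ p)%:E) (subr0 _)).
  rewrite (_ : rnorm _ = 0) ?powR0 ?gt_eqF//.
  exact: (etrans (congr1 (fun u : R[i] => rnorm u) (subrr _)) (rnorm0 _)).
have gE : lp_sum p g = (\sum_(x \in F) a x + \esum_(x in ~` F) a x)%E.
  rewrite -esum_fset// /lp_sum (esumID F) ?setTI// => x _.
  exact: a0.
have Ffin : (\sum_(x \in F) a x)%E \is a fin_num.
  rewrite ge0_fin_numE ?fsume_ge0//; apply: le_lt_trans goo.
  by rewrite gE leeDl// esum_ge0.
have Cge : (0 <= \esum_(x in ~` F) a x)%E by apply: esum_ge0 => x _; exact: a0.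
have Cfin : (\esum_(x in ~` F) a x)%E \is a fin_num.
  rewrite ge0_fin_numE//; apply: le_lt_trans goo.
  by rewrite gE leeDr// fsume_ge0// => x _; exact: a0.
by move: ltF; rewrite gE lteBlDr// lteD2lE// => /ltW.
Qed.

Lemma coef_ker S (g : lp p1 X) x :
  (forall z, (g z : R[i]) <> 0 -> coef S x z = 0) -> (S g x : R[i]) = 0.
Proof.
move=> gS; apply: rnorm_eq0; apply/eqP; rewrite eq_le rnorm_ge0 andbT.
have oS0 : 0 <= opnorm S by apply: opnorm_ge0; exact: bopP.
apply/ler_addgt0Pr => e e0; rewrite add0r.
have d0 : 0 < e / (opnorm S + 1) by rewrite divr_gt0// ltr_wpDl.
have [s gs] := delta_dense g d0.
set h := (X in g - X) in gs.
have Sh : (S h x : R[i]) = 0.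
  rewrite /h bop_sum lp_sum_ev big1// => z _.
  have gz0 : (g z : R[i]) * coef S x z = 0.
    by have [->|/eqP/gS->] := eqVneq (g z : R[i]) 0; rewrite ?mul0r ?mulr0.
  by rewrite bop_linZ; exact: gz0.
have -> : (S g x : R[i]) = (S (g - h) x : R[i]).
  have hx : (S g x : R[i]) - (S h x : R[i]) = S g x by rewrite Sh subr0.
  by rewrite bop_linD bop_linN; exact: esym hx.
apply: (le_trans (rnorm_le_lp_nrm p1 x (lp_sum_fin _))).
rewrite -rnorm_lpE; apply: (le_trans (le_opnorm _ (bopP S))).
apply: (@le_trans _ _ ((opnorm S + 1) * (e / (opnorm S + 1)))).
  by apply: ler_pM => //; [exact: rnorm_ge0|rewrite lerDl|exact: ltW].
by rewrite mulrC divfK// gt_eqF// ltr_wpDl.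
Qed.

Lemma finite_propagationM S T : finite_propagation S -> finite_propagation T ->
  finite_propagation (S * T).
Proof.
move=> /finite_propagationP[r Sr] /finite_propagationP[s Ts].
apply/finite_propagationP; exists (r + s) => x y xy.
rewrite leNgt; apply/negP => rs; apply: xy.
rewrite /coef bopME; apply: coef_ker => z /Ts zy.
have [//|/eqP/Sr xz] := eqVneq (coef S x z) 0.
have := le_lt_trans (le_trans (metric_triangle x z y) (lerD xz zy)) rs.
by rewrite ltxx.
Qed.

End RoeAlgebra.
Arguments finite_propagation {R p} p1 X _.
Arguments roe_set {R p} p1 X _.

Definition roe_pred (R : realType) (p : R) (p1 : 1 <= p) (X : metricType R) :
  {pred bop (lp p1 X)} := mem (roe_set p1 X).
Arguments roe_pred {R p} p1 X _.

(* The same set as a ring of its own. *)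
Record roe_algebra (R : realType) (p : R) (p1 : 1 <= p) (X : metricType R) :=
  Roe {
  roe_op :> bop (lp p1 X);
  roe_opP : roe_op \in roe_pred p1 X }.

Section RoeRing.
Variables (R : realType) (p : R) (p1 : 1 <= p) (X : metricType R).

Lemma roe_pred_subring : subring_closed (roe_pred p1 X).
Proof.
apply: closure_subring.
- exact: finite_propagation1.
- exact: finite_propagationB.
- exact: finite_propagationM.
Qed.

HB.instance Definition _ := [isSub for @roe_op R p p1 X].
HB.instance Definition _ := [Choice of roe_algebra p1 X by <:].
HB.instance Definition _ :=
  GRing.isSubringClosed.Build (bop (lp p1 X)) (roe_pred p1 X)
    roe_pred_subring.
HB.instance Definition _ :=
  GRing.SubChoice_isSubPzRing.Build (bop (lp p1 X)) (roe_pred p1 X)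
    (roe_algebra p1 X)
    roe_pred_subring.

End RoeRing.

(* Main.v *)
Require Import Defs.
From HB Require Import structures.
From mathcomp Require Import all_boot all_order all_algebra.
From mathcomp Require Import all_classical all_reals all_analysis.
From mathcomp Require Import complex.
From mathcomp Require Import lra.

Import Order.TTheory GRing.Theory Num.Theory.
Import numFieldNormedType.Exports.
Local Open Scope classical_set_scope.
Local Open Scope ring_scope.

(** The four properties are proved equivalent in a cycle.

    Quasidiagonality implies stable finiteness, for any set of operators on a
    normed space E ([quasidiagonal_left_inverse]). Let x, y be matrices over
    the set with x y = 1, and suppose that y x <> 1; then the idempotent
    1 - y x has a nonzero vector xi in its range, and x xi = 0. Take a finite
    rank contraction P that almost commutes with all entries of x and y and
    almost fixes xi, and compress: a = P x P and b = P y P act on the finite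
    dimensional space P(E^n). There a b is close to the identity, so b is
    injective, hence surjective, and P xi = b eta for some eta. As
    |eta| <= 2 |a b eta| and a b eta = P x P xi, which is close to
    P x xi = 0, both eta and P xi = b eta are small; but P xi is close to xi.
    Surjectivity of b, a matter of dimension, takes the place of an inverse of
    a b given by a Neumann series.

    Stable finiteness implies finiteness by looking at 1 x 1 matrices.

    Finiteness forces the r-components to be finite. An infinite component
    is an infinite connected graph in which all balls of radius r are finite,
    so it contains an injective ray u with steps of length at most r (Konig's
    lemma, [infinite_ray]). The operator that moves u n to u n.+1 and fixes
    every point off the ray has finite propagation; it has a left inverse of
    the same kind, but it is not invertible, since its range misses the basis
    vector at u 0 ([ray_not_finite]).

    If the components are all finite, then finitely many operators of the
    closure and finitely many vectors are approximated by operators whose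
    propagation is at most some r and by vectors with finite support.
    The union G of the r-components that meet these supports is finite. An
    operator of propagation at most r has no nonzero matrix coefficient between
    G and its complement, so the coordinate projection onto G commutes with the
    approximants and fixes the approximating vectors
    ([finite_components_quasidiagonal]). *)

Set Implicit Arguments.
Unset Strict Implicit.

(** * Injective endomorphisms of finite dimensional subspaces *)

(** A nontrivial relation between v, b v, b (b v), ... can be divided by b, as b
    is injective, until its constant coefficient is nonzero; it then exhibits
    v as an image. *)
Lemma iter_relation_surj {K : fieldType} {L : lmodType K} (b : {linear L -> L})
    (V : L -> Prop) (v : L) (m : nat) (u : nat -> K) :
  V 0 -> (forall a x y, V x -> V y -> V (a *: x + y)) ->
  (forall x, V x -> V (b x)) -> (forall x, V x -> b x = 0 -> x = 0) -> V v ->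
  \sum_(j < m) u j *: iter j b v = 0 -> (exists2 j, (j < m)%N & u j != 0) ->
  exists2 w, V w & b w = v.
Proof.
move=> V0 VD Vb inj Vv; elim: m u => [|m IH] u; first by move=> _ [].
rewrite big_ord_recl /=.
under eq_bigr do rewrite -linearZ.
rewrite -linear_sum.
set w := \sum_(i < m) _.
have Vw : V w.
  rewrite /w; elim/big_ind : _ => //.
    by move=> x y Vx Vy; rewrite -[x]scale1r; apply: VD.
  move=> i _; rewrite -[_ *: _]addr0; apply: VD => //=.
  by elim: (nat_of_ord i) => //= k; exact: Vb.
have [u0 rel [j jm uj]|u0 rel _] := eqVneq (u 0%N) 0.
  apply: (IH (fun j => u j.+1)).
    by apply: (inj w Vw); rewrite -rel u0 scale0r add0r.
  by case: j jm uj => [|j] jm uj; [rewrite u0 eqxx in uj | exists j].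
exists (- (u 0%N)^-1 *: w); first by rewrite -[_ *: _]addr0; apply: VD.
move/eqP: rel; rewrite addrC addr_eq0 => /eqP bw.
by rewrite linearZ /= bw scalerN scaleNr opprK scalerA mulVf// scale1r.
Qed.

(** The space need not come with a basis: [e] is only a finite family whose span
    contains V. It bounds the number of independent vectors among the iterates
    of b at v, which yields the relation wanted by [iter_relation_surj]. *)
Lemma injective_endo_surj {K : fieldType} {L : lmodType K} (b : {linear L -> L})
    (V : L -> Prop) (k : nat) (e : 'I_k -> L) :
  V 0 -> (forall a x y, V x -> V y -> V (a *: x + y)) ->
  (forall x, V x -> exists c : 'I_k -> K, x = \sum_(i < k) c i *: e i) ->
  (forall x, V x -> V (b x)) -> (forall x, V x -> b x = 0 -> x = 0) ->
  forall v, V v -> exists2 w, V w & b w = v.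
Proof.
move=> V0 VD Ve Vb inj v Vv.
have Vit j : V (iter j b v) by elim: j => //= j; exact: Vb.
have [c cE] := choice (fun j => Ve _ (Vit j)).
pose C : 'M[K]_(k.+1, k) := \matrix_(j, i) c j i.
have /rowV0Pn[u /sub_kermxP uC u0] : kermx C != 0.
  by rewrite kermx_eq0 /row_free neq_ltn ltnS rank_leq_col.
(* The row u, continued by zeros to a sequence. *)
pose u' j :=
  if (j < k.+1)%N =P true is ReflectT h then u ord0 (Ordinal h) else 0.
have u'E (j : 'I_k.+1) : u' j = u ord0 j.
  rewrite /u'; case: eqP => [h|]; last by case; exact: ltn_ord.
  by congr (u _ _); apply: val_inj.
apply: (iter_relation_surj (V := V) (m := k.+1) (u := u')) => //.
  under eq_bigr do rewrite u'E cE scaler_sumr.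
  rewrite exchange_big /= big1// => i _.
  under eq_bigr do rewrite scalerA.
  rewrite -scaler_suml.
  move/rowP/(_ i): uC; rewrite !mxE.
  under eq_bigr do rewrite mxE.
  by move=> ->; rewrite scale0r.
have /rV0Pn[j uj] := u0.
by exists (val j); [exact: ltn_ord | rewrite u'E].
Qed.

(** * Matrices of operators acting on tuples of vectors *)

Section Amplification.
Variables (R : realType) (E : normedModType R[i]) (n : nat).
Implicit Types (x y : 'M[bop E]_n) (v w : {ffun 'I_n -> E}).

Definition mxact x v : {ffun 'I_n -> E} := [ffun i => \sum_j x i j (v j)].

Lemma mxact_is_linear x : linear (mxact x).
Proof.
move=> a v w; apply/ffunP => i; rewrite !ffunE scaler_sumr -big_split /=.
by apply: eq_bigr => j _; rewrite !ffunE bop_linD bop_linZ.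
Qed.

HB.instance Definition _ x :=
  GRing.isLinear.Build R[i] {ffun 'I_n -> E} {ffun 'I_n -> E} *:%R (mxact x)
    (mxact_is_linear x).

Lemma bop_sumE (I : Type) (s : seq I) (F : I -> bop E) z :
  (\sum_(i <- s) F i) z = \sum_(i <- s) F i z.
Proof. by elim: s => [|i s IH]; rewrite ?big_nil// !big_cons bopDE IH. Qed.

Lemma bop_linsum (T : bop E) (I : Type) (s : seq I) (F : I -> E) :
  T (\sum_(i <- s) F i) = \sum_(i <- s) T (F i).
Proof.
by elim: s => [|i s IH]; rewrite ?big_nil ?bop_lin0// !big_cons bop_linD IH.
Qed.

Lemma mxactM x y v : mxact (x *m y) v = mxact x (mxact y v).
Proof.
apply/ffunP => i; rewrite !ffunE.
under eq_bigr do rewrite mxE bop_sumE.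
rewrite exchange_big /=; apply: eq_bigr => j _.
by rewrite ffunE bop_linsum; apply: eq_bigr.
Qed.

Lemma mxactB x y v : mxact (x - y) v = mxact x v - mxact y v.
Proof.
apply/ffunP => i; rewrite !ffunE -sumrB.
by apply: eq_bigr => j _; rewrite !mxE bopDE bopNE.
Qed.

Lemma mxact_scalar (P : bop E) v i : mxact P%:M v i = P (v i).
Proof.
rewrite ffunE (bigD1 i)//= mxE eqxx mulr1n big1 ?addr0// => j ji.
by rewrite mxE eq_sym (negbTE ji).
Qed.

Lemma mxact1 v : mxact 1%:M v = v.
Proof. by apply/ffunP => i; rewrite mxact_scalar. Qed.

(** Any norm on tuples would do; for the sum norm, the sum of the norms of the
    entries of a matrix is a bound on its action. *)
Definition sumnorm v : R := \sum_i rnorm (v i).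
Definition mxnorm x : R := \sum_i \sum_j rnorm (x i j).

Lemma sumnorm_ge0 v : 0 <= sumnorm v.
Proof. by apply: sumr_ge0 => i _; exact: rnorm_ge0. Qed.

Lemma mxnorm_ge0 x : 0 <= mxnorm x.
Proof. by do 2 (apply: sumr_ge0 => ? _); exact: rnorm_ge0. Qed.

Lemma sumnormD v w : sumnorm (v + w) <= sumnorm v + sumnorm w.
Proof.
by rewrite -big_split; apply: ler_sum => i _; rewrite ffunE rnormD.
Qed.

Lemma sumnorm_eq0 v : sumnorm v <= 0 -> v = 0.
Proof.
move=> v0; apply/ffunP => i; rewrite ffunE; apply: rnorm_eq0; apply/eqP.
rewrite eq_le rnorm_ge0 andbT (le_trans _ v0)// /sumnorm (bigD1 i)//= lerDl.
by apply: sumr_ge0 => j _; exact: rnorm_ge0.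
Qed.

Lemma rnorm_bop_le (T : bop E) z : rnorm (T z) <= rnorm T * rnorm z.
Proof. by rewrite rnorm_bopE le_opnorm//; exact: bopP. Qed.

Lemma rnorm_sum (V : normedModType R[i]) (I : Type) (s : seq I) (F : I -> V) :
  rnorm (\sum_(i <- s) F i) <= \sum_(i <- s) rnorm (F i).
Proof.
elim: s => [|i s IH]; first by rewrite !big_nil rnorm0.
by rewrite !big_cons (le_trans (rnormD _ _))// lerD2l.
Qed.

Lemma sumnorm_mxact x v : sumnorm (mxact x v) <= mxnorm x * sumnorm v.
Proof.
rewrite /mxnorm mulr_suml; apply: ler_sum => i _.
rewrite ffunE (le_trans (rnorm_sum _ _))// mulr_suml.
apply: ler_sum => j _; apply: (le_trans (rnorm_bop_le _ _)).
rewrite ler_wpM2l ?rnorm_ge0// /sumnorm (bigD1 j)//= lerDl.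
by apply: sumr_ge0 => k _; exact: rnorm_ge0.
Qed.

Lemma sumnorm_scalar (P : bop E) v : rnorm P <= 1 ->
  sumnorm (mxact P%:M v) <= sumnorm v.
Proof.
move=> P1; apply: ler_sum => i _; rewrite mxact_scalar.
by rewrite (le_trans (rnorm_bop_le _ _))// ler_piMl// rnorm_ge0.
Qed.

Lemma mxnorm_commutator_le x (P : bop E) (e : R) :
  (forall i j, rnorm (x i j * P - P * x i j) <= e) ->
  mxnorm (x *m P%:M - P%:M *m x) <= (n * n)%:R * e.
Proof.
move=> xP.
have -> : (n * n)%:R * e = \sum_(i < n) \sum_(j < n) e.
  by rewrite !sumr_const !card_ord -mulrnA mulr_natl.
apply: ler_sum => i _; apply: ler_sum => j _; rewrite !mxE.
rewrite (bigD1 j)//= [X in _ + X - _]big1 => [|k kj]; last first.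
  by rewrite mxE (negbTE kj) mulr0n mulr0.
rewrite (bigD1 i)//= [X in _ - (_ + X)]big1 => [|k ki]; last first.
  by rewrite mxE eq_sym (negbTE ki) mulr0n mul0r.
by rewrite !mxE !eqxx !mulr1n !addr0.
Qed.

(** The amplification of P has finite rank again: its range is spanned by the
    tuples with one nonzero entry, taken from a family that spans the range
    of P. *)
Lemma finite_rank_amplification (P : bop E) : finite_rank P ->
  exists (k : nat) (b : 'I_k -> {ffun 'I_n -> E}),
    forall v, exists c : 'I_k -> R[i], mxact P%:M v = \sum_(l < k) c l *: b l.
Proof.
case=> m [b bP]; pose I := ('I_n * 'I_m)%type.
exists #|{: I}|, (fun l => let: (i, k) := enum_val l in
  [ffun i' => if i' == i then b k else 0]) => v.
have [c cE] := choice (fun i => bP (v i)).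
exists (fun l => let: (i, k) := enum_val l in c i k).
pose G (q : I) : {ffun 'I_n -> E} :=
  c q.1 q.2 *: [ffun i' => if i' == q.1 then b q.2 else 0].
rewrite (eq_bigr (fun l => G (enum_val l))); last first.
  by move=> l _; rewrite /G; case: (enum_val l).
rewrite -(big_enum_val (A := {: I}) G) -(pair_bigA _ (fun i k => G (i, k))) /=.
apply/ffunP => i; rewrite mxact_scalar cE sum_ffunE (bigD1 i)//=.
rewrite [X in _ + X]big1 => [|i' i'i]; last first.
  by rewrite sum_ffunE big1// => k _;
    rewrite !ffunE eq_sym (negbTE i'i) scaler0.
rewrite addr0 sum_ffunE; apply: eq_bigr => k _.
by rewrite !ffunE eqxx.
Qed.

End Amplification.

(** * Quasidiagonal sets and one-sided inverses *)

(** With N the sum norm, Kx and Ky the bounds [mxnorm x] and [mxnorm y], xi a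
    nonzero vector of the kernel of x, and e the tolerance in the definition of
    quasidiagonality, the compressions a and b of x and y satisfy
    N (w - a (b w)) <= Kx n^2 e N w and N (a (P xi)) <= n^2 e N xi. The first
    bound makes b injective on the range of P once Kx n^2 e <= 1/2; together
    they give N xi <= n e + 2 Ky n^2 e N xi, which fails for small e. *)
Lemma quasidiagonal_left_inverse (R : realType) (E : normedModType R[i])
    (A : set (bop E)) (n : nat) (x y : 'M[bop E]_n) :
  quasidiagonal_set A ->
  (forall i j, A (x i j)) -> (forall i j, A (y i j)) ->
  x *m y = 1%:M -> y *m x = 1%:M.
Proof.
move=> qA Ax Ay xy1; apply: contrapT => yx1.
(* A matrix acts on tuples faithfully, as columns with one entry z show. *)
have [v yxv] : exists v, mxact (y *m x) v <> v.
  apply: contrapT => /forallNP yxv; apply: yx1; apply/matrixP => i j.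
  apply: bop_ext => z.
  have := contrapT (yxv [ffun k => if k == j then z else 0]).
  move/ffunP/(_ i); rewrite !ffunE (bigD1 j)//= big1 => [|k kj]; last first.
    by rewrite ffunE (negbTE kj) bop_lin0.
  rewrite ffunE eqxx addr0 => ->; rewrite [X in _ = bop_fun X z]mxE.
  by case: eqP.
pose xi := v - mxact (y *m x) v.
have xxi : mxact x xi = 0.
  by rewrite linearB /= -!mxactM mulmxA xy1 mul1mx subrr.
have Nxi : 0 < sumnorm xi.
  rewrite ltNge; apply/negP => /sumnorm_eq0 /eqP; rewrite subr_eq0 => /eqP.
  by move=> h; apply: yxv; rewrite -h.
clearbody xi => {v yxv}.
set N := @sumnorm R E n in Nxi.
pose Kx := mxnorm x; pose Ky := mxnorm y.
have Kx0 : 0 <= Kx by exact: mxnorm_ge0.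
have Ky0 : 0 <= Ky by exact: mxnorm_ge0.
pose c : R := (n * n)%:R.
have c0 : 0 <= c by rewrite ler0n.
pose e := Num.min (2 * c * Kx + 1)^-1 (N xi / (n%:R + 2 * Ky * c * N xi + 1)).
have d0 : 0 < n%:R + 2 * Ky * c * N xi + 1.
  by rewrite ltr_wpDl// addr_ge0 ?ler0n// !mulr_ge0// ltW.
have d'0 : 0 < 2 * c * Kx + 1 by rewrite ltr_wpDl// !mulr_ge0.
have e0 : 0 < e by rewrite lt_min invr_gt0 d'0 divr_gt0.
have ex : Kx * (c * e) <= 2^-1.
  have : e <= (2 * c * Kx + 1)^-1 by rewrite ge_min lexx.
  rewrite -[(_ + 1)^-1]mul1r ler_pdivlMr// => h.
  rewrite -[leRHS]mul1r ler_pdivlMr//; nra.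
have exi : e * (n%:R + 2 * Ky * c * N xi) < N xi.
  have : e <= N xi / (n%:R + 2 * Ky * c * N xi + 1) by rewrite ge_min lexx orbT.
  rewrite ler_pdivlMr// => h; lra.
have [] := qA ([set x i j | i in [set: 'I_n] & j in [set: 'I_n]] `|`
      [set y i j | i in [set: 'I_n] & j in [set: 'I_n]])
    [set xi i | i in [set: 'I_n]] e.
- by rewrite finite_setU; split; apply: finite_image2; exact: finite_finset.
- by move=> _ [|] [i _ [j _ <-]].
- by apply: finite_image; exact: finite_finset.
- exact: e0.
move=> P [frP PP P1 comm appr].
have rP : rnorm P <= 1 by rewrite -lecR rnormE P1.
have commx : forall i j, rnorm (x i j * P - P * x i j) <= e.
  by move=> i j; rewrite ltW// -ltcR rnormE comm//; left;
    exists i => //; exists j.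
have commy : forall i j, rnorm (y i j * P - P * y i j) <= e.
  by move=> i j; rewrite ltW// -ltcR rnormE comm//; right;
    exists i => //; exists j.
pose Q : {linear {ffun 'I_n -> E} -> {ffun 'I_n -> E}} := mxact P%:M.
have QE w : Q w = mxact P%:M w by [].
have QQ w : Q (Q w) = Q w by rewrite !QE -mxactM -scalar_mxM PP.
have NQ w : N (Q w) <= N w by exact: sumnorm_scalar.
have NX (z : 'M[bop E]_n) w :
    (forall i j, rnorm (z i j * P - P * z i j) <= e) ->
    N (mxact z (Q w) - Q (mxact z w)) <= c * e * N w.
  move=> zP; rewrite !QE -!mxactM -mxactB (le_trans (sumnorm_mxact _ _))//.
  by rewrite ler_wpM2r ?sumnorm_ge0// mxnorm_commutator_le.
pose b : {linear {ffun 'I_n -> E} -> {ffun 'I_n -> E}} := Q \o mxact y.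
have bE w : b w = Q (mxact y w) by [].
pose a w := Q (mxact x w).
have ab w : Q w = w -> N w <= 2 * N (a (b w)).
  move=> Qw.
  have E1 : w - a (b w) = Q (mxact x (mxact y (Q w) - Q (mxact y w))).
    rewrite Qw.
    have -> : mxact x (mxact y w - Q (mxact y w)) = w - mxact x (b w).
      by rewrite linearB; congr (_ - _); rewrite -[LHS]mxactM xy1 mxact1.
    by rewrite linearB Qw.
  have : N (w - a (b w)) <= Kx * (c * e) * N w.
    rewrite E1 (le_trans (NQ _))// (le_trans (sumnorm_mxact _ _))// -mulrA.
    by rewrite ler_wpM2l// NX.
  have := sumnormD (w - a (b w)) (a (b w)); rewrite subrK -/N.
  have := sumnorm_ge0 w; rewrite -/N; nra.
(* b is injective on the range of P, hence maps it onto itself. *)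
have [k [g gP]] := finite_rank_amplification n frP.
have [||w Qw|w Qw|w Qw bw0|eta Qeta beta] :=
  injective_endo_surj (b := b) (V := fun w => Q w = w) (e := g)
    _ _ _ _ _ (QQ xi).
- exact: linear0.
- by move=> t u w Qu Qw; rewrite linearP Qu Qw.
- by have [l lE] := gP w; exists l; rewrite -lE -QE.
- by rewrite bE QQ.
- apply: sumnorm_eq0; apply: (le_trans (ab w Qw)).
  rewrite bw0 /a !linear0 /N /sumnorm big1 ?mulr0// => i _.
  by rewrite ffunE rnorm0.
have NQxi : N (Q xi) <= 2 * Ky * (c * e * N xi).
  have aQxi : a (Q xi) = Q (mxact x (Q xi) - Q (mxact x xi)).
    by rewrite xxi linear0 subr0.
  have h1 : N (a (Q xi)) <= c * e * N xi.
    by rewrite aQxi (le_trans (NQ _))// NX.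
  have h2 : N eta <= 2 * (c * e * N xi).
    by rewrite (le_trans (ab _ Qeta))// ler_pM2l// beta.
  rewrite -beta bE (le_trans (NQ _))// (le_trans (sumnorm_mxact _ _))//.
  by rewrite (mulrC 2 Ky) -[leRHS]mulrA ler_wpM2l.
have Nappr : N (xi - Q xi) <= n%:R * e.
  have -> : n%:R * e = \sum_(i < n) e by rewrite sumr_const card_ord mulr_natl.
  apply: ler_sum => i _; rewrite 2!ffunE -rnormN opprB ltW// -ltcR rnormE.
  by rewrite mxact_scalar appr//; exists i.
have := sumnormD (xi - Q xi) (Q xi); rewrite subrK -/N => h.
have := lt_le_trans exi (le_trans h (lerD Nappr NQxi)).
by rewrite ltNge; case/negP; lra.
Qed.

(** * Finiteness of rings *)

(** For e = x y = 1 the element f = y x is automatically an idempotent below 1,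
    so finiteness of the unit says that one-sided inverses are two-sided. *)
Lemma finite_algebraP (A : pzRingType) :
  finite_algebra A <-> forall x y : A, x * y = 1 -> y * x = 1.
Proof.
split=> [[_ fin] x y xy|inv].
  apply: fin; first by rewrite /is_idempotent mulrA -(mulrA y) xy mulr1.
    by exists x, y.
  by split; rewrite ?mul1r ?mulr1.
split; first by rewrite /is_idempotent mul1r.
by move=> f _ [x [y [xy ->]]] _; exact: inv (esym xy).
Qed.

Lemma stably_finite_finite (A : pzRingType) :
  stably_finite A -> finite_algebra A.
Proof.
move=> /(_ 1) /finite_algebraP inv; apply/finite_algebraP => x y xy.
have xyM : (x%:M : 'M[A]_1) *m y%:M = 1%:M by rewrite -scalar_mxM xy.
have : (y%:M : 'M[A]_1) *m x%:M = 1%:M by exact: inv xyM.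
by rewrite -scalar_mxM => /matrixP/(_ ord0 ord0); rewrite !mxE.
Qed.

(** The matrix ring over the Roe algebra embeds entrywise in the matrix ring
    over all bounded operators, where the identity can be checked. *)
Lemma quasidiagonal_stably_finite (R : realType) (p : R) (p1 : 1 <= p)
    (X : metricType R) :
  quasidiagonal_set (roe_set p1 X) -> stably_finite (roe_algebra p1 X).
Proof.
move=> qd n; apply/finite_algebraP => x y xy.
have valM (a b : 'M[roe_algebra p1 X]_n) :
    map_mx val (a *m b) = map_mx val a *m map_mx val b :> 'M[bop (lp p1 X)]_n.
  exact: map_mxM.
have val1 :
    map_mx val (1%:M : 'M[roe_algebra p1 X]_n) = 1%:M :> 'M[bop (lp p1 X)]_n.
  exact: map_mx1.
have Roe (a : 'M[roe_algebra p1 X]_n) i j : roe_set p1 X (map_mx val a i j).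
  by rewrite mxE; have := roe_opP (a i j); rewrite inE.
have yx : map_mx val y *m map_mx val x = 1%:M :> 'M[bop (lp p1 X)]_n.
  apply: (quasidiagonal_left_inverse qd); [exact: Roe|exact: Roe|].
  by rewrite -valM -val1; congr map_mx.
rewrite -valM -val1 in yx.
apply/matrixP => i j; apply: val_inj.
by move/matrixP/(_ i j): yx; rewrite !mxE.
Qed.

(** * Rays in infinite graphs with finite neighbourhoods *)

Section Ray.
Variables (X : choiceType) (e : rel X).

Definition reach_avoiding (s : seq X) (x : X) : set X :=
  [set y | exists t,
    [/\ path e x t, last x t = y & all (fun z => z \notin s) (x :: t)]].

(** A path from x can be shortened to one that never returns to x. So every
    point that x reaches is x itself or is reached, avoiding x, from one of the
    finitely many successors of x; one of these must reach infinitely many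
    points. *)
Lemma reach_step (s : seq X) (x : X) :
  finite_set [set y | e x y] -> infinite_set (reach_avoiding s x) ->
  exists y, e x y /\ infinite_set (reach_avoiding (x :: s) y).
Proof.
move=> fx inf; apply: contrapT => /forallNP nex; apply: inf.
apply: (@sub_finite_set _ _ ([set x] `|`
   \bigcup_(y in [set y | e x y]) reach_avoiding (x :: s) y)).
  move=> z [t [/shortenP[[|y t'] pt ut st]]] <-; first by left.
  rewrite /= => /andP[xs ts]; right; exists y; first by case/andP: pt.
  exists t'; split => //; first by case/andP: pt.
  apply/allP => w wt; rewrite inE negb_or; apply/andP; split.
    by case/andP: ut => xt _; apply: contraNneq xt => <-.
  by apply: (allP ts); exact: st.
rewrite finite_setU; split; first exact: finite_set1.
apply: bigcup_finite => // y exy; apply: contrapT => inf; exact: (nex y).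
Qed.

(** Konig's lemma. The states of the recursion are pairs (visited points,
    current point) such that infinitely many points remain reachable from the
    current one without touching the visited ones; this is what keeps the ray
    injective. *)
Lemma infinite_ray (x : X) :
  (forall y, finite_set [set z | e y z]) ->
  infinite_set (reach_avoiding [::] x) ->
  exists u : nat -> X, injective u /\ forall n, e (u n) (u n.+1).
Proof.
move=> fin inf.
pose P (a : seq X * X) := infinite_set (reach_avoiding a.1 a.2).
have /choice[f fP] : forall a : {a | P a}, exists b : {a | P a},
    (sval b).1 = (sval a).2 :: (sval a).1 /\ e (sval a).2 (sval b).2.
  move=> -[[s y] /= sy]; have [z [yz zinf]] := reach_step (fin y) sy.
  by exists (exist _ (y :: s, z) zinf).
pose v n := iter n f (exist P ([::], x) inf).
pose u n := sval (v n).
have uS n : (u n.+1).1 = (u n).2 :: (u n).1 by case: (fP (v n)).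
have ue n : e (u n).2 (u n.+1).2 by case: (fP (v n)).
have fresh n : (u n).2 \notin (u n).1.
  have /infinite_setN0[z [t [_ _ /= /andP[]]]] // : P (u n) by exact: svalP.
have old m k : (u m).2 \in (u (m + k).+1).1.
  elim: k => [|k IH]; first by rewrite addn0 uS mem_head.
  by rewrite addnS uS inE IH orbT.
have neq m n : (m < n)%N -> (u m).2 <> (u n).2.
  move=> mn umn; have := fresh n; rewrite -umn.
  by rewrite -(subnKC mn) addSn old.
exists (fun n => (u n).2); split=> // m n umn.
by case: (ltngtP m n) => // mn; case: (neq _ _ mn).
Qed.

End Ray.

(** * Operators induced by partial injections *)

Definition partial_injection (X : Type) (g : X -> option X) : Prop :=
  forall x y z, g x = Some z -> g y = Some z -> x = y.

Section Pullback.
Variables (R : realType) (p : R) (p1 : 1 <= p) (X : choiceType).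
Variables (g : X -> option X) (g_inj : partial_injection g).

Let p0 : 0 < p. Proof. exact: lt_le_trans p1. Qed.

(** Composition with a partial map g, extended by zero where g is undefined.
    When g is injective this is a contraction of the lp-space; partial maps
    cover both shifts along a ray and coordinate projections. *)
Definition pullback_fun (f : X -> R[i]^o) : X -> R[i]^o :=
  fun x => if g x is Some y then f y else 0.

(** Since g is injective on its domain D, the sum on the left is the sum of
    |f|^p over the image of D. *)
Lemma lp_sum_pullback (f : X -> R[i]^o) :
  (lp_sum p (pullback_fun f) <= lp_sum p f)%E.
Proof.
pose a x := (rnorm (f x : R[i]) `^ p)%:E.
have a0 x : (0 <= a x)%E by rewrite lee_fin powR_ge0.
pose D := [set x | g x <> None].
pose h x := odflt x (g x).
have hD x : D x -> g x = Some (h x) by rewrite /D /h /=; case: (g x).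
have -> : lp_sum p (pullback_fun f) = (\esum_(x in D) a (h x))%E.
  rewrite [RHS]esum_mkcond; apply: eq_esum => x _; rewrite /pullback_fun.
  case: ifPn => [/set_mem /hD ->//|/negP xD].
  case gx : (g x) => [y|]; first by case: xD; rewrite inE /D /= gx.
  by rewrite rnorm0 powR0 ?gt_eqF.
rewrite -esum_image => [|x y /set_mem xD /set_mem yD hxy].
  rewrite esum_mkcond; apply: le_esum => x _; rewrite -/(a x).
  by case: ifP.
by apply: (g_inj (hD _ xD)); rewrite hxy; exact: hD.
Qed.

Lemma pullback_in_lp (f : lp p1 X) : pullback_fun f \in lp_pred p1 X.
Proof.
rewrite lp_predE; exact: le_lt_trans (lp_sum_pullback _) (lp_sum_fin f).
Qed.

Definition pullback_lp (f : lp p1 X) : lp p1 X := Lp (pullback_in_lp f).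

Lemma rnorm_pullback_lp f : rnorm (pullback_lp f) <= rnorm f.
Proof.
rewrite !rnorm_lpE; apply: (lp_nrm_le p1); first exact: lp_nrm_ge0.
by rewrite -lp_nrm_powR// ?lp_sum_fin// lp_sum_pullback.
Qed.

Lemma pullback_bounded : pullback_lp \in bop_pred (lp p1 X).
Proof.
apply/bop_predP; split; last by exists 1 => x; rewrite mul1r rnorm_pullback_lp.
move=> c u v; apply: val_inj; apply/funext => x /=; rewrite /pullback_fun.
case gx : (g x) => [y|].
  by rewrite [RHS]/(c * pullback_fun u x + pullback_fun v x) /pullback_fun gx.
rewrite [RHS]/(c * pullback_fun u x + pullback_fun v x) /pullback_fun gx.
by have /esym : c * 0 + 0 = 0 by rewrite mulr0 addr0.
Qed.

Definition pullback : bop (lp p1 X) := Bop pullback_bounded.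

Lemma pullbackE (f : lp p1 X) x :
  pullback f x = if g x is Some y then f y else 0.
Proof. by []. Qed.

Lemma rnorm_pullback : rnorm pullback <= 1.
Proof.
rewrite rnorm_bopE; apply: opnorm_le => //; first exact: bopP.
by move=> f; rewrite mul1r; exact: rnorm_pullback_lp.
Qed.

End Pullback.

Lemma lp_bop_ext (R : realType) (p : R) (p1 : 1 <= p) (X : choiceType)
    (S T : bop (lp p1 X)) :
  (forall f x, S f x = T f x) -> S = T.
Proof.
move=> ST; apply: bop_ext => f; apply: val_inj; apply/funext => x; exact: ST.
Qed.

Section Shift.
Variables (R : realType) (p : R) (p1 : 1 <= p) (X : metricType R).

Lemma finite_propagation_pullback (g : X -> option X)
    (gi : partial_injection g) (r : R) :
  (forall x y, g x = Some y -> mdist x y <= r) ->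
  finite_propagation p1 X (pullback p1 gi).
Proof.
move=> gr; apply/finite_propagationP; exists r => x y.
rewrite /coef pullbackE; case gx: (g x) => [z|//] /=.
by case: eqVneq => [zy _|_ //]; rewrite -zy; exact: gr.
Qed.

Lemma finite_propagation_roe T :
  finite_propagation p1 X T -> T \in roe_pred p1 X.
Proof. by move=> fT; rewrite inE; exact: subset_closure. Qed.

(** With [pullback] contravariant, the pullback along the backward shift [bwd],
    undefined at u 0, is the isometry that moves the ray forward, and the
    pullback along [fwd] is its left inverse. In the other order the product
    kills the basis vector at u 0. *)
Lemma ray_not_finite (u : nat -> X) (r : R) : 0 <= r -> injective u ->
  (forall n, mdist (u n) (u n.+1) <= r) -> ~ finite_algebra (roe_algebra p1 X).
Proof.
move=> r0 uI ur /finite_algebraP fin.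
pose idx x : option nat := if pselect (exists n, u n = x) is left h
  then Some (projT1 (cid h)) else None.
have idxE n : idx (u n) = Some n.
  rewrite /idx; case: pselect => [h|]; last by case; exists n.
  by case: cid => m /= /uI ->.
have idxS x n : idx x = Some n -> x = u n.
  rewrite /idx; case: pselect => // h [<-]; by case: cid.
pose fwd x := Some (if idx x is Some n then u n.+1 else x).
pose bwd x :=
  if idx x is Some n then (if n is m.+1 then Some (u m) else None) else Some x.
(* fwd and bwd are inverse to each other as relations. *)
have fbi x y : bwd y = Some x <-> fwd x = Some y.
  rewrite /bwd /fwd; split.
    case yn : (idx y) => [[|n]|] // [<-]; last by rewrite yn.
    by rewrite idxE -(idxS _ _ yn).
  case xn : (idx x) => [n|] [<-]; last by rewrite xn.
  by rewrite idxE -(idxS _ _ xn).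
have fi : partial_injection fwd.
  by move=> x y z /fbi xz /fbi; rewrite xz => -[].
have bi : partial_injection bwd.
  by move=> x y z /fbi xz /fbi; rewrite xz => -[].
have fr x y : fwd x = Some y -> mdist x y <= r.
  rewrite /fwd; case xn : (idx x) => [n|] [<-]; last by rewrite mdistxx.
  by rewrite {1}(idxS _ _ xn).
have br x y : bwd x = Some y -> mdist x y <= r.
  by rewrite metric_sym => /fbi/fr.
pose S := Roe (finite_propagation_roe (finite_propagation_pullback fi fr)).
pose T := Roe (finite_propagation_roe (finite_propagation_pullback bi br)).
have ST : S * T = 1.
  apply: val_inj; apply: lp_bop_ext => f x; rewrite rmorphM rmorph1.
  rewrite bopME [LHS]/(pullback_fun fwd (pullback_fun bwd f) x) /pullback_fun.
  by case fx : (fwd x) => [y|//]; have /fbi -> := fx.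
have TS0 : val (T * S) (delta p1 (u 0%N)) (u 0%N) = 0.
  rewrite rmorphM.
  rewrite bopME
    [LHS]/(pullback_fun bwd (pullback_fun fwd (delta p1 (u 0%N))) (u 0%N)).
  by rewrite /pullback_fun /bwd idxE.
have : val (1 : roe_algebra p1 X) (delta p1 (u 0%N)) (u 0%N) = 0.
  by rewrite -(fin _ _ ST).
rewrite rmorph1.
rewrite [LHS]/((_ == _)%:R : R[i]) eqxx => /eqP; by rewrite oner_eq0.
Qed.

End Shift.

(** * Finite components give commuting projections *)

(** Needed twice: for one propagation that serves finitely many operators, and
    for one finite set that contains the supports of finitely many vectors. *)
Lemma finite_common_bound (T U : Type) (u0 : U)
    (Q : T -> U -> Prop) (M : set T) :
  (forall u v, exists w, forall t, Q t u \/ Q t v -> Q t w) ->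
  finite_set M -> (forall t, M t -> exists u, Q t u) ->
  exists u, forall t, M t -> Q t u.
Proof.
elim/Pchoice: T => T in Q M *.
move=> dir /finite_seqP[s ->] /=; elim: s => [|t s IH] Qs; first by exists u0.
have [u Qu] := IH (fun t' ts => Qs t' (mem_behead (s := t :: s) ts)).
have [v Qv] := Qs t (mem_head _ _); have [w Qw] := dir u v.
exists w => t'; rewrite inE => /predU1P[->|/Qu Q']; apply: Qw;
  [by right|by left].
Qed.

Section FiniteComponents.
Variables (R : realType) (p : R) (p1 : 1 <= p) (X : metricType R).

Definition restrict (G : set X) (x : X) : option X :=
  if x \in G then Some x else None.

Lemma restrict_inj (G : set X) : partial_injection (restrict G).
Proof.
by move=> x y z; rewrite /restrict; do 2 case: ifP => // _; case=> -> [->].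
Qed.

Definition proj (G : set X) : bop (lp p1 X) :=
  pullback p1 (restrict_inj (G := G)).

Lemma projE G (f : lp p1 X) x : proj G f x = if x \in G then f x else 0.
Proof.
rewrite [LHS]/(pullback_fun (restrict G) f x) /pullback_fun /restrict.
by case: ifP.
Qed.

Lemma proj_idem G : proj G * proj G = proj G.
Proof.
apply: lp_bop_ext => f x; rewrite bopME !projE.
by case: (x \in G).
Qed.

Lemma proj_finite_rank G : finite_set G -> finite_rank (proj G).
Proof.
move=> /finite_seqP[s0 Gs]; pose s := undup s0.
exists (size s), (fun i => delta p1 (tnth (in_tuple s) i)) => f.
exists (fun i => f (tnth (in_tuple s) i)).
apply: val_inj; apply/funext => x.
rewrite [LHS]projE [RHS]lp_sum_ev.
have -> : (x \in G) = (x \in s).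
  by rewrite mem_undup; apply/idP/idP; rewrite inE Gs.
transitivity (\sum_(z <- s) (f z : R[i]) * (x == z)%:R); last first.
  by rewrite big_tnth; apply: eq_bigr.
case: ifPn => xs.
  rewrite (bigD1_seq x) ?undup_uniq//= eqxx mulr1 big1 ?addr0// => z zx.
  by rewrite eq_sym (negbTE zx) mulr0.
rewrite big1_seq// => z /andP[_ zs]; case: eqP => [xz|_]; last by rewrite mulr0.
by move: zs xs; rewrite -xz => ->.
Qed.

Lemma rnorm_proj G : G !=set0 -> rnorm (proj G) = 1.
Proof.
case=> z Gz; apply/eqP; rewrite eq_le rnorm_pullback /=.
have nd : 0 < rnorm (delta p1 z).
  rewrite lt_neqAle rnorm_ge0 andbT eq_sym; apply/eqP => /rnorm_eq0 d0.
  have : delta p1 z z = 0 by rewrite d0.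
  by rewrite [LHS]/((_ == _)%:R : R[i]) eqxx => /eqP; rewrite oner_eq0.
have Pd : proj G (delta p1 z) = delta p1 z.
  apply: val_inj; apply/funext => x; rewrite [LHS]projE; case: ifPn => //.
  move=> xG; rewrite [RHS]/((x == z)%:R : R[i]); case: eqP => // xz.
  by move: xG; rewrite xz mem_set.
have := rnorm_bop_le (proj G) (delta p1 z).
by rewrite Pd -[leLHS]mul1r ler_pM2r.
Qed.

(** The hypothesis says that T is block diagonal for G and its complement. *)
Lemma proj_commute G (T : bop (lp p1 X)) :
  (forall x y, coef T x y <> 0 -> (x \in G) = (y \in G)) ->
  T * proj G = proj G * T.
Proof.
move=> TG; apply: lp_bop_ext => f x; rewrite bopME [RHS]projE.
case: ifP => xG; last first.
  apply: coef_ker => z; rewrite projE; case: ifP => // zG _.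
  by apply: contrapT => /TG; rewrite xG zG.
have : T (proj G f - f) x = 0.
  apply: coef_ker => z fz; apply: contrapT => /TG; rewrite xG => zG.
  apply: fz; rewrite [LHS]/((proj G f z : R[i]) - f z) projE -zG.
  exact: subrr.
rewrite bop_linD bop_linN => /eqP.
by rewrite [X in X == _]/((T (proj G f) x : R[i]) - T f x) subr_eq0 => /eqP.
Qed.

Definition component_saturated (r : R) (G : set X) : Prop :=
  forall x y, mdist x y <= r -> G x -> G y.

Lemma saturation_finite (r : R) (F : set X) :
  (forall x : X, finite_set (component_at r x)) -> finite_set F ->
  exists G, [/\ finite_set G, F `<=` G & component_saturated r G].
Proof.
move=> fin finF; exists (\bigcup_(x in F) component_at r x); split.
- by apply: bigcup_finite.
- by move=> x Fx; exists x => //; exists [::].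
- move=> x y xy [z Fz [s [zs zsx]]]; exists z => //; exists (rcons s y).
  by rewrite rcons_path zs zsx last_rcons.
Qed.

Lemma bop_contractionMl (P T : bop (lp p1 X)) :
  rnorm P <= 1 -> rnorm (P * T) <= rnorm T.
Proof.
by move=> P1; apply: (le_trans (rnorm_bopM _ _)); rewrite ler_piMl ?rnorm_ge0.
Qed.

Lemma bop_contractionMr (P T : bop (lp p1 X)) :
  rnorm P <= 1 -> rnorm (T * P) <= rnorm T.
Proof.
by move=> P1; apply: (le_trans (rnorm_bopM _ _)); rewrite ler_piMr ?rnorm_ge0.
Qed.

(** If T is within e/2 of S and commutes with the contraction P, then
    S P - P S = (S - T) P - P (S - T) has norm less than e; similarly
    P xi - xi = P (xi - h) - (xi - h) when P h = h. *)
Lemma finite_components_quasidiagonal (x0 : X) :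
  (forall (r : R) (x : X), 0 < r -> finite_set (component_at r x)) ->
  quasidiagonal_set (roe_set p1 X).
Proof.
move=> fin M F e finM MA finF e0.
have e2 : 0 < e / 2 by rewrite divr_gt0.
have [r rM] : exists r : R, forall S, M S -> exists T, rnorm (S - T) < e / 2 /\
    forall x y, coef T x y <> 0 -> mdist x y <= r.
  apply: (finite_common_bound 0 _ finM) => [u v|S /MA/closure_bopP/(_ _ e2)].
    exists (Num.max u v) => S.
    move=> [] [T [ST Tr]]; exists T; split=> // x y /Tr xy;
      by rewrite le_max xy ?orbT.
  by case=> T /finite_propagationP[r Tr] ST; exists r, T.
have [s sF] : exists s : seq X, forall xi, F xi -> exists h : lp p1 X,
    rnorm (xi - h) < e / 2 /\ forall x, x \notin s -> h x = 0.
  apply: (finite_common_bound [::] _ finF) => [u v|xi _].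
    exists (u ++ v) => xi [] [h [xih hs]]; exists h; split=> // x;
      by rewrite mem_cat negb_or => /andP[? ?]; exact: hs.
  have [s xis] := delta_dense xi e2.
  exists s, (\sum_(z <- s) (xi z : R[i]) *: delta p1 z); split=> // x xs.
  rewrite lp_sum_ev big1_seq// => z /andP[_ zs].
  rewrite [LHS]/((xi z : R[i]) * (x == z)%:R).
  case: eqP => [xz|_]; last by exact: mulr0.
  by move: zs xs; rewrite -xz => ->.
have r1 : 0 < Num.max r 1 by rewrite lt_max ltr01 orbT.
(* The point x0 is added so that the projection is nonzero, of norm one; the
   maximum with 1 because components are assumed finite at positive scales. *)
have [G [finG sG satG]] := saturation_finite (fun x => fin _ x r1)
  (finite_seq (x0 :: s)).
have P1 : rnorm (proj G) = 1.
  by apply: rnorm_proj; exists x0; apply: sG; rewrite /= mem_head.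
exists (proj G); split.
- exact: proj_finite_rank.
- exact: proj_idem.
- by rewrite -rnormE P1.
- move=> S /rM[T [ST Tr]]; rewrite -rnormE ltcR.
  have TP : T * proj G = proj G * T.
    apply: proj_commute => x y /Tr xy.
    by apply/idP/idP; rewrite !inE; apply: satG;
      rewrite ?[mdist y x]metric_sym le_max xy.
  have -> : S * proj G - proj G * S = (S - T) * proj G - proj G * (S - T).
    by rewrite mulrBl mulrBr TP opprB addrA subrK.
  rewrite (le_lt_trans (rnormD _ _))// rnormN [e]splitr.
  apply: ltrD.
    by apply: le_lt_trans ST; apply: bop_contractionMr; rewrite P1.
  by apply: le_lt_trans ST; apply: bop_contractionMl; rewrite P1.
- move=> xi /sF[h [xih hs]]; rewrite -rnormE ltcR.
  have Ph : proj G h = h.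
    apply: val_inj; apply/funext => x; rewrite [LHS]projE; case: ifPn => // xG.
    apply/esym/hs; apply: contra xG => xs; rewrite inE; apply: sG.
    by rewrite /= inE xs orbT.
  have -> : proj G xi - xi = proj G (xi - h) - (xi - h).
    by rewrite bop_linD bop_linN Ph opprB addrA subrK.
  rewrite (le_lt_trans (rnormD _ _))// rnormN [e]splitr.
  apply: ltrD; last exact: xih.
  apply: (le_lt_trans _ xih); apply: (le_trans (rnorm_bop_le _ _)).
  by rewrite ler_piMl ?rnorm_ge0 ?P1.
Qed.

End FiniteComponents.

(** * The equivalence *)

Lemma finite_algebra_finite_components (R : realType) (p : R) (p1 : 1 <= p)
    (X : metricType R) : bounded_geometry X ->
  finite_algebra (roe_algebra p1 X) ->
  forall (r : R) (x : X), 0 < r -> finite_set (component_at r x).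
Proof.
move=> bg fin r x r0; apply: contrapT => inf.
have [y||u [uI ur]] := @infinite_ray X (fun a b => mdist a b <= r) x.
- by have [N NP] := bg r r0; apply/finite_set_leP; exists N; exact: NP.
- apply: sub_infinite_set inf => y [t [xt ty]]; exists t; split=> //.
  by apply/allP.
- exact: ray_not_finite (ltW r0) uI ur fin.
Qed.

Unset Implicit Arguments.
Set Strict Implicit.

Theorem theoremA (R : realType) (X : metricType R) (p : R) (p1 : 1 <= p) :
  [set: X] !=set0 -> bounded_geometry X ->
  [<-> quasidiagonal_set (roe_set p1 X);
       stably_finite (roe_algebra p1 X);
       finite_algebra (roe_algebra p1 X);
       forall (r : R) (x : X), 0 < r -> finite_set (component_at r x)].
Proof.
move=> [x0 _] bg; tfae.
- exact: quasidiagonal_stably_finite.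
- exact: stably_finite_finite.
- exact: finite_algebra_finite_components.
- exact: finite_components_quasidiagonal.
Qed.
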